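(* Let $\mathcal{H}$ be a complex Hilbert space and let $A,B\in\mathcal{B}(\mathcal{H})$. Then there exist isometries $U,V\in\mathcal{B}(\mathcal{H})$ such that $$|A+B|_{\mathrm{qsym}}\le U\,|A|_{\mathrm{qsym}}\,U^*+V\,|B|_{\mathrm{qsym}}\,V^*.$$
   Context: $\mathcal{B}(\mathcal{H})$ is the space of bounded linear operators on $\mathcal{H}$. For $T\in\mathcal{B}(\mathcal{H})$, the quadratic symmetric modulus is $|T|_{\mathrm{qsym}}=\left(\frac{T^*T+TT^*}{2}\right)^{1/2}$. For self-adjoint operators, $X\le Y$ means $Y-X$ is positive. An isometry is an operator $U$ with $U^*U=I$. *)

(* Defs.v *)
From HB Require Import structures.
From mathcomp Require Import all_boot all_order all_algebra.
From mathcomp Require Import complex.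
From mathcomp Require Import all_classical all_reals.
From mathcomp Require Import topology normedtype.

Set Implicit Arguments.
Unset Strict Implicit.
Unset Printing Implicit Defensive.

Import Order.TTheory GRing.Theory Num.Theory.
Import numFieldNormedType.Exports.
Local Open Scope classical_set_scope.
Local Open Scope ring_scope.
Local Open Scope complex_scope.

(* A complex Hilbert space is a complete normed space over R[i] whose norm comes
   from an inner product.  The inner product is linear in its first argument and
   conjugate-linear in the second. *)
HB.mixin Record CompleteNormedModule_isHilbert (R : realType) H
    of CompleteNormedModule R[i] H := {
  inner : {dot H for (@Num.conj R[i] : R[i] -> R[i])} ;
  inner_norm : forall x : H, inner x x = `|x| ^+ 2
}.

#[short(type="hilbertType")]
HB.structure Definition Hilbert (R : realType) :=
  { H of CompleteNormedModule R[i] H & CompleteNormedModule_isHilbert R H }.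

Section Operators.
Context {R : realType} {H : hilbertType R}.
Implicit Types S T U X Y : H -> H.

(* For a linear map, being bounded near 0 is having a finite operator norm, see
   [linear_boundedP]. *)
Definition bounded_op : set (H -> H) :=
  [set T | linear T /\ bounded_near T (nbhs (0 : H))].

(* The adjoint of a bounded operator exists and is unique, by the Riesz
   representation theorem.  The default 0 is only used when T is not bounded. *)
Definition adjoint T : H -> H :=
  xget (0 : H -> H) [set S | bounded_op S /\
    forall x y : H, inner (T x) y = inner x (S y)].

(* In R[i], 0 <= z says that z is a nonnegative real number, so that positive
   operators are self-adjoint. *)
Definition positive_op T : Prop :=
  bounded_op T /\ forall x : H, 0 <= inner (T x) x.

Definition op_le X Y : Prop := positive_op (Y - X).

(* A positive operator has exactly one positive square root.  The default 0 is
   only used when T is not positive. *)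
Definition op_sqrt T : H -> H :=
  xget (0 : H -> H) [set S | positive_op S /\ S \o S = T].

Definition qsym_modulus T : H -> H :=
  op_sqrt (2^-1 *: ((adjoint T \o T) + (T \o adjoint T))).

Definition isometry_op U : Prop := bounded_op U /\ adjoint U \o U = id.

End Operators.

(* Main.v *)
From HB Require Import structures.
Require Import Defs.
From mathcomp Require Import all_boot all_order all_algebra.
From mathcomp Require Import complex all_classical all_reals.
From mathcomp Require Import topology normedtype.
From mathcomp Require Import sequences interval_inference ring lra.

(* Write M, Q_A, Q_B for the quadratic symmetric moduli of S = A + B, A and B.
   Since M^2 = (S^* S + S S^* ) / 2, the polar decomposition of the column
   (S, S^* ) / sqrt 2 splits M as Z_A + Z_B, with |Z_A x| <= |Q_A x| and
   |Z_B x| <= |Q_B x|.  It remains to dominate Re Z by U N U^* for an isometry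
   U whenever |Z x| <= |N x| for all x.

   In finite dimension this is a comparison of eigenvalues.  In general, let P
   be the support of the positive part of Re Z.  There is Y, with range in that
   of P, such that Y^* Y <= N and Re Z <= Y Y^*.  If Y x = 0 and P x = x, then
   x = 0, so that 1 - P embeds ker Y into ker Y^*; hence the partial isometry
   of the polar decomposition of Y extends to an isometry U with
   U (Y^* Y) U^* = Y Y^*.

   All estimates use the real inner product [< x, y >] = Re <x, y>. *)

Set Implicit Arguments.
Unset Strict Implicit.
Unset Printing Implicit Defensive.

Import Order.TTheory GRing.Theory Num.Theory.
Import numFieldNormedType.Exports.
Local Open Scope classical_set_scope.
Local Open Scope ring_scope.
Local Open Scope complex_scope.

Reserved Notation "[< x , y >]" (format "[<  x ,  y  >]").

Section HilbertSpace.
Context {R : realType} {H : hilbertType R}.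
Implicit Types (x y z u v w : H) (a : R) (c : R[i]).
Implicit Types (A B C D G L M N P S T U Y Z : H -> H).

(** * The real inner product *)

Definition rdot x y : R := complex.Re (inner x y).
Definition nrm x : R := complex.Re `|x|.
Local Notation "[< x , y >]" := (rdot x y).

Lemma ge0_complexE c : 0 <= c -> c = (complex.Re c)%:C.
Proof. by case: c => u v; rewrite lecE/= => /andP[/eqP ->]. Qed.

Lemma normE x : `|x| = (nrm x)%:C.
Proof. exact/ge0_complexE. Qed.

Lemma nrm_ge0 x : 0 <= nrm x.
Proof. by have := normr_ge0 x; rewrite normE lecR. Qed.

Lemma nrmD x y : nrm (x + y) <= nrm x + nrm y.
Proof. by have := ler_normD x y; rewrite !normE -rmorphD/= lecR. Qed.

Lemma nrm0 : nrm 0 = 0.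
Proof. by rewrite /nrm normr0. Qed.

Lemma nrmN x : nrm (- x) = nrm x.
Proof. by rewrite /nrm normrN. Qed.

Lemma nrmBC x y : nrm (x - y) = nrm (y - x).
Proof. by rewrite -nrmN opprB. Qed.

Lemma nrmZ a x : nrm (a%:C *: x) = `|a| * nrm x.
Proof.
rewrite {1}/nrm normrZ normE normc_def/= expr0n/= addr0 sqrtr_sqr.
by rewrite mul0r subr0.
Qed.

Lemma rdotC x y : [< x, y >] = [< y, x >].
Proof.
by rewrite /rdot (hermC inner x y) /= expr0 mul1r; case: (inner y x).
Qed.

Lemma rdotDl x y z : [< x + y, z >] = [< x, z >] + [< y, z >].
Proof. by rewrite /rdot linearDl raddfD. Qed.

Lemma rdotNl x y : [< - x, y >] = - [< x, y >].
Proof. by rewrite /rdot linearNl raddfN. Qed.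

Lemma rdotDr x y z : [< z, x + y >] = [< z, x >] + [< z, y >].
Proof. by rewrite rdotC rdotDl !(rdotC z). Qed.

Lemma rdotNr x y : [< x, - y >] = - [< x, y >].
Proof. by rewrite rdotC rdotNl rdotC. Qed.

Lemma rdotBl x y z : [< x - y, z >] = [< x, z >] - [< y, z >].
Proof. by rewrite rdotDl rdotNl. Qed.

Lemma rdotBr x y z : [< z, x - y >] = [< z, x >] - [< z, y >].
Proof. by rewrite rdotDr rdotNr. Qed.

Lemma rdot0l x : [< 0, x >] = 0.
Proof. by rewrite -(subrr 0) rdotBl subrr. Qed.

Lemma rdot0r x : [< x, 0 >] = 0.
Proof. by rewrite rdotC rdot0l. Qed.

Lemma rdotZl a x y : [< a%:C *: x, y >] = a * [< x, y >].
Proof. by rewrite /rdot linearZl_LR/=; case: (inner x y) => u v /=;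
  rewrite mul0r subr0. Qed.

Lemma rdotZr a x y : [< x, a%:C *: y >] = a * [< x, y >].
Proof. by rewrite rdotC rdotZl rdotC. Qed.

Lemma rdot_conj c x y : [< c *: x, y >] = [< x, c^* *: y >].
Proof.
by rewrite /rdot linearZl_LR linearZr_LR/=; congr (complex.Re (_ * _));
  rewrite [RHS]conjCK.
Qed.

(** The second argument is conjugate-linear, so multiplying it by i turns the imaginary part of
    [inner x y] into a real part. For complex-linear operators, identities of the real product thus
    lift to [inner]. *)
Lemma inner_rdot x y : inner x y = [< x, y >] +i* [< x, 'i%C *: y >].
Proof.
rewrite /rdot linearZr_LR/=; case: (inner x y) => u v /=.
by congr (_ +i* _); ring.
Qed.

Lemma rdotxx x : [< x, x >] = nrm x ^+ 2.
Proof. by rewrite /rdot inner_norm normE -rmorphXn. Qed.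

Lemma rdotBB x y : [< x - y, x - y >] =
  [< x, x >] - 2 * [< x, y >] + [< y, y >].
Proof. by rewrite rdotBl !rdotBr (rdotC y x); ring. Qed.

Lemma rdot_ge0 x : 0 <= [< x, x >].
Proof. by rewrite rdotxx sqr_ge0. Qed.

Lemma rdot_eq0 x : [< x, x >] = 0 -> x = 0.
Proof.
rewrite rdotxx => /eqP; rewrite sqrf_eq0 => /eqP h.
by apply: normr0_eq0; rewrite normE h.
Qed.

Lemma rdot_le0 x : [< x, x >] <= 0 -> x = 0.
Proof. by move=> h; apply/rdot_eq0/le_anti; rewrite h rdot_ge0. Qed.

Lemma rdot_inj y z : (forall x, [< x, y >] = [< x, z >]) -> y = z.
Proof.
move=> h; apply/eqP; rewrite -subr_eq0; apply/eqP/rdot_eq0.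
by rewrite rdotBr h subrr.
Qed.

Lemma nrm_le x y : (nrm x <= nrm y) = ([< x, x >] <= [< y, y >]).
Proof. by rewrite !rdotxx ler_sqr ?nnegrE ?nrm_ge0. Qed.

Lemma nrm_eq0 x : nrm x = 0 -> x = 0.
Proof. by move=> h; apply: rdot_eq0; rewrite rdotxx h expr0n. Qed.

Lemma nrm_gt0 x : x <> 0 -> 0 < nrm x.
Proof. by move=> x0; rewrite lt_def nrm_ge0 andbT; apply/eqP => /nrm_eq0. Qed.

Lemma cauchy_schwarz x y : `|[< x, y >]| <= nrm x * nrm y.
Proof.
suff h z w : [< z, w >] <= nrm z * nrm w.
  by rewrite ler_norml h andbT lerNl -rdotNl -(nrmN x) h.
have [->|/eqP/nrm_gt0 pz] := eqVneq z 0; first by rewrite rdot0l nrm0 mul0r.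
have [->|/eqP/nrm_gt0 pw] := eqVneq w 0; first by rewrite rdot0r nrm0 mulr0.
have := rdot_ge0 ((nrm w)%:C *: z - (nrm z)%:C *: w).
rewrite rdotBl !rdotBr !rdotZl !rdotZr !rdotxx (rdotC w z).
have -> : nrm w * (nrm w * nrm z ^+ 2) - nrm w * (nrm z * [< z, w >]) -
  (nrm z * (nrm w * [< z, w >]) - nrm z * (nrm z * nrm w ^+ 2)) =
  (nrm z * nrm w) * (2 * (nrm z * nrm w - [< z, w >])) by ring.
by rewrite pmulr_rge0 ?mulr_gt0// pmulr_rge0// subr_ge0.
Qed.

(** The norm of [H] is [R[i]]-valued, but a positive radius in [R[i]] is a positive real, so limits
    can be computed with the real norm. *)
Lemma nrm_cvg (u : nat -> H) (l : H) :
  (fun n => nrm (u n - l)) @ \oo --> (0 : R) -> u @ \oo --> l.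
Proof.
move=> h; apply/cvgrPdist_le => e e0.
have er := ge0_complexE (ltW e0).
have e1 : 0 < complex.Re e by move: e0; rewrite er ltcR.
move/cvgrPdist_le : h => /(_ _ e1); apply: filterS => n.
by rewrite sub0r normrN ger0_norm ?nrm_ge0// er normE nrmBC lecR.
Qed.

Lemma cvg_nrm (u : nat -> H) (l : H) :
  u @ \oo --> l -> (fun n => nrm (u n - l)) @ \oo --> (0 : R).
Proof.
move=> /cvgrPdist_le h; apply/cvgrPdist_le => e e0.
have := h e%:C; rewrite ltcR => /(_ e0); apply: filterS => n.
by rewrite sub0r normrN ger0_norm ?nrm_ge0// normE nrmBC lecR.
Qed.

Lemma nrm_cauchy_cvg (u : nat -> H) :
  (forall e : R, 0 < e -> exists N : nat, forall m n : nat, (N <= m)%N ->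
    (N <= n)%N ->
     nrm (u m - u n) < e) -> exists l : H, u @ \oo --> l.
Proof.
move=> h; suff : cvg (u @ \oo) by move=> /cvg_ex.
apply/cauchy_cvgP/cauchy_ballP => e e0.
have er := ge0_complexE (ltW e0).
have e1 : 0 < complex.Re e by move: e0; rewrite er ltcR.
have [N hN] := h _ e1.
near_simpl; exists ([set n | (N <= n)%N], [set n | (N <= n)%N]).
  by split; exists N.
move=> [m n] /= [Nm Nn]; rewrite -ball_normE /ball_/= er normE ltcR; exact: hN.
Qed.

Lemma cvg_rdot (u : nat -> H) (l y : H) :
  u @ \oo --> l -> (fun n => [< u n, y >]) @ \oo --> [< l, y >].
Proof.
move=> /cvg_nrm h; apply/cvgrPdist_le => e e0.
have p : 0 < nrm y + 1 by have := nrm_ge0 y; lra.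
have q : 0 < e / (nrm y + 1) by rewrite divr_gt0.
move/cvgrPdist_le : h => /(_ _ q); apply: filterS => n.
rewrite sub0r normrN ger0_norm ?nrm_ge0// ler_pdivlMr// => h.
rewrite -rdotBl; apply: le_trans (cauchy_schwarz _ _) _; rewrite nrmBC.
have := nrm_ge0 (u n - l); nra.
Qed.

(** * Bounded operators *)

Lemma bounded_opP T :
  bounded_op T <-> linear T /\ exists a, forall x, nrm (T x) <= a * nrm x.
Proof.
suff h : linear T -> bounded_near T (nbhs (0 : H)) <->
    exists a, forall x, nrm (T x) <= a * nrm x.
  by split=> -[lT] /(h lT).
move=> lT.
pose f : {linear H -> H} := HB.pack T (GRing.isLinear.Build _ _ _ _ T lT).
rewrite (linear_boundedP f); split=> [/pinfty_ex_gt0 [r /ltW r0 hr]|[a ha]].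
  exists (complex.Re r) => x.
  by have := hr x; rewrite !normE {1}(ge0_complexE r0) -rmorphM/= lecR.
exists `|a|%:C; split; first by rewrite realE lecR normr_ge0.
move=> r ar x; have a0 : 0 <= `|a|%:C by rewrite lecR normr_ge0.
have r0 : 0 <= r by apply: le_trans a0 (ltW ar).
move: ar; rewrite !normE (ge0_complexE r0) -rmorphM/= ltcR lecR => ar.
apply: le_trans (ha x) _; rewrite ler_wpM2r ?nrm_ge0//.
exact: le_trans (ler_norm _) (ltW ar).
Qed.

Lemma bounded_op_gt0 T : bounded_op T ->
  exists2 a, 0 < a & forall x, nrm (T x) <= a * nrm x.
Proof.
move=> /bounded_opP[_ [a ha]]; exists (`|a| + 1) => [|x].
  by have := normr_ge0 a; lra.
apply: le_trans (ha x) _; rewrite ler_wpM2r ?nrm_ge0//.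
by have := ler_norm a; lra.
Qed.

Lemma op_linear T (bT : bounded_op T) c x y : T (c *: x + y) = c *: T x + T y.
Proof. by case/bounded_opP: bT => l _; rewrite l. Qed.

Lemma opD T (bT : bounded_op T) x y : T (x + y) = T x + T y.
Proof. by rewrite -[x]scale1r (op_linear bT) !scale1r. Qed.

Lemma op0 T (bT : bounded_op T) : T 0 = 0.
Proof. by apply: (addrI (T 0)); rewrite -(opD bT) !addr0. Qed.

Lemma opZ T (bT : bounded_op T) c x : T (c *: x) = c *: T x.
Proof. by rewrite -[c *: x]addr0 (op_linear bT) (op0 bT) addr0. Qed.

Lemma opN T (bT : bounded_op T) x : T (- x) = - T x.
Proof. by rewrite -[- x]scaleN1r (opZ bT) scaleN1r. Qed.

Lemma opB T (bT : bounded_op T) x y : T (x - y) = T x - T y.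
Proof. by rewrite (opD bT) (opN bT). Qed.

Lemma bounded_op_id : bounded_op (idfun : H -> H).
Proof. by apply/bounded_opP; split=> //; exists 1 => x; rewrite mul1r. Qed.

Lemma bounded_op_comp S T : bounded_op S -> bounded_op T -> bounded_op (S \o T).
Proof.
move=> bS bT; have [s s0 hs] := bounded_op_gt0 bS.
have [t t0 ht] := bounded_op_gt0 bT.
apply/bounded_opP; split=> [c x y|];
  first by rewrite /= (op_linear bT) (op_linear bS).
exists (s * t) => x /=; apply: le_trans (hs _) _.
by rewrite -mulrA ler_wpM2l// ltW.
Qed.

Lemma bounded_opD S T : bounded_op S -> bounded_op T -> bounded_op (S + T).
Proof.
move=> bS bT; have [s s0 hs] := bounded_op_gt0 bS.
have [t t0 ht] := bounded_op_gt0 bT.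
apply/bounded_opP; split=> [c x y|].
  by rewrite !fctE (op_linear bS) (op_linear bT) scalerDr addrACA.
exists (s + t) => x; rewrite fctE; apply: le_trans (nrmD _ _) _.
by rewrite mulrDl lerD.
Qed.

Lemma bounded_opZ a T : bounded_op T -> bounded_op (a%:C *: T).
Proof.
move=> bT; have [t t0 ht] := bounded_op_gt0 bT.
apply/bounded_opP; split=> [c x y|].
  by rewrite !fctE (op_linear bT) scalerDr !scalerA mulrC.
exists (`|a| * t) => x; rewrite fctE nrmZ -mulrA ler_wpM2l//.
Qed.

Lemma bounded_opN T : bounded_op T -> bounded_op (- T).
Proof. by move=> bT; rewrite -scaleN1r -(rmorphN1 (real_complex R));
  exact: bounded_opZ. Qed.

Lemma bounded_opB S T : bounded_op S -> bounded_op T -> bounded_op (S - T).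
Proof. by move=> bS bT; apply: bounded_opD => //; exact: bounded_opN. Qed.

(** Im <T x, x> = 0 for all x polarizes to symmetry, by evaluation at x, i y and x + i y.
    Conversely, symmetry makes <T x, i x> equal to its own opposite. *)
Lemma positive_opP T : positive_op T <-> [/\ bounded_op T,
  forall x y, [< T x, y >] = [< x, T y >] & forall x, 0 <= [< T x, x >]].
Proof.
split=> [[bT pT]|[bT sT pT]]; last first.
  split=> // x; rewrite lecE inner_rdot/= pT andbT.
  have : [< T x, 'i%C *: x >] = - [< T x, 'i%C *: x >].
    rewrite {1}sT (opZ bT) rdotC rdot_conj -rdotNr -scaleNr;
      congr [< _, _ *: _ >].
    by apply/eqP; rewrite eq_complex/= oppr0 !eqxx.
  lra.
have re x : 0 <= [< T x, x >] by have := pT x;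
  rewrite lecE inner_rdot => /andP[].
have im x : [< T x, 'i%C *: x >] = 0.
  by have := pT x; rewrite lecE inner_rdot/= => /andP[/eqP].
split=> // x y.
have := im (x + 'i%C *: y); have := im ('i%C *: y); have := im x.
rewrite (opD bT) (opZ bT) scalerDr scalerA.
have -> : 'i%C * 'i%C = -1 :> R[i] by rewrite -expr2 sqr_i.
rewrite !scaleN1r rdotDl !rdotDr !rdotNr !(rdot_conj 'i%C) scalerA.
have -> : ('i%C : R[i])^* * 'i%C = 1.
  by apply/eqP; rewrite eq_complex/=; apply/andP; split; apply/eqP; ring.
by rewrite scale1r (rdotC x (T y)) => *; lra.
Qed.

(** * Variational construction of adjoints, projections and factorizations *)

Lemma cvg_nrmr (s : nat -> H) (l : H) :
  s @ \oo --> l -> (fun n => nrm (s n)) @ \oo --> nrm l.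
Proof.
move=> /cvg_nrm/cvgrPdist_le h; apply/cvgrPdist_le => e /h; apply: filterS => n.
rewrite sub0r normrN ger0_norm ?nrm_ge0//; apply: le_trans.
rewrite ler_norml; have := nrmD (l - s n) (s n); have := nrmD (s n - l) l.
by rewrite !subrK (nrmBC l) => *; apply/andP; split; lra.
Qed.

(* The double orthogonal complement of the range, that is, its closure. *)
Definition range_closure M z :=
  forall w, (forall u, [< M u, w >] = 0) -> [< z, w >] = 0.

Lemma range_closure_image M x : range_closure M (M x).
Proof. by move=> w; apply. Qed.

Lemma range_closureD M z w :
  range_closure M z -> range_closure M w -> range_closure M (z + w).
Proof. by move=> hz hw v hv; rewrite rdotDl hz// hw// addr0. Qed.

Lemma range_closureZ M c z : bounded_op M ->
  range_closure M z -> range_closure M (c *: z).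
Proof.
move=> bM hz w hw; rewrite rdot_conj hz// => u.
by rewrite -rdot_conj -(opZ bM) hw.
Qed.

Lemma range_closureB M z w : bounded_op M ->
  range_closure M z -> range_closure M w -> range_closure M (z - w).
Proof.
by move=> bM hz hw; rewrite -scaleN1r; apply/range_closureD/range_closureZ.
Qed.

(** z - w lies in the closed range and is orthogonal to the range, hence to itself. This is the
    uniqueness principle behind the constructions below. *)
Lemma range_closure_inj M z w : bounded_op M ->
  range_closure M z -> range_closure M w ->
  (forall u, [< M u, z >] = [< M u, w >]) -> z = w.
Proof.
move=> bM hz hw h; apply/eqP; rewrite -subr_eq0; apply/eqP/rdot_eq0.
by apply: (range_closureB bM hz hw) => u; rewrite rdotBr h subrr.
Qed.

(* For M = id this is the Riesz representation theorem; z is the limit of M x_n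
   for a minimising sequence x_n of |M x|^2 - 2 f x. *)
Lemma riesz_range M (f : H -> R) (k : R) : bounded_op M -> 0 <= k ->
  (forall a x y, f (a%:C *: x + y) = a * f x + f y) ->
  (forall x, f x <= nrm (M x) * k) ->
  exists z, [/\ forall x, [< M x, z >] = f x, range_closure M z & nrm z <= k].
Proof.
move=> bM k0 fL fk.
pose J x : R := [< M x, M x >] - 2 * f x.
have Jlb x : - k ^+ 2 <= J x.
  by rewrite /J rdotxx; have := fk x; have := sqr_ge0 (nrm (M x) - k); nra.
pose I : R := inf (range J).
have hI : has_inf (range J).
  by split; [exists (J 0), 0|exists (- k ^+ 2) => _ [x _ <-]].
have IJ x : I <= J x by apply: ge_inf; [exact: hI.2|exists x].
have /choice[s hs] n : exists x, J x < I + n.+1%:R^-1.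
  have n0 : 0 < n.+1%:R^-1 :> R by rewrite invr_gt0.
  by have [_ [x _ <-] ?] := inf_adherent n0 hI; exists x.
have f0 : f 0 = 0 by have := fL 1 0 0; rewrite scaler0 addr0; lra.
have f2 x y : f ((2^-1 : R)%:C *: (x + y)) = 2^-1 * (f x + f y).
  by rewrite -[_ *: _]addr0 fL f0 addr0 -{1}[x]scale1r fL mul1r.
(* The parallelogram law, with I <= J at the midpoint of x and y; it makes M x_n a Cauchy
   sequence. *)
have Jxy x y : [< M x - M y, M x - M y >] <= 2 * (J x - I) + 2 * (J y - I).
  have := IJ ((2^-1 : R)%:C *: (x + y)); rewrite /J f2 (opZ bM) (opD bM).
  rewrite rdotZl rdotZr !(rdotDl, rdotDr, rdotNl, rdotNr) (rdotC (M y) (M x));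
    lra.
have [z sz] : exists z : H, (fun n => M (s n)) @ \oo --> z.
  apply: nrm_cauchy_cvg => e e0;
    have e4 : 0 < e ^+ 2 / 4 by rewrite divr_gt0// exprn_gt0.
  near \oo => n0.
  exists n0 => m n n0m n0n.
  have hh p : (n0 <= p)%N -> J (s p) - I < e ^+ 2 / 4.
    move=> n0p; rewrite ltrBlDl; apply: lt_trans (hs p) _; rewrite ltrD2l.
    apply: le_lt_trans (_ : n0.+1%:R^-1 < _); last first.
      by near: n0; exact: (near_infty_natSinv_lt (PosNum e4)).
    by rewrite lef_pV2 ?posrE// ler_nat.
  have := Jxy (s m) (s n); have := hh _ n0m; have := hh _ n0n.
  by rewrite rdotxx => *; rewrite -ltr_sqr ?nnegrE ?nrm_ge0 ?(ltW e0)//; lra.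
have zf x : [< M x, z >] = f x.
  pose d : R := [< M x, z >] - f x.
  (* First variation: I <= J (s_n + t x) and J s_n < I + 1 / (n + 1); let n tend to infinity. *)
  have key (t : R) : 0 <= 2 * t * d + t ^+ 2 * [< M x, M x >].
    have cv : (fun n => 2 * t * ([< M (s n), M x >] - f x) +
      t ^+ 2 * [< M x, M x >]
       + n.+1%:R^-1) @ \oo --> 2 * t * d + t ^+ 2 * [< M x, M x >] + 0.
      apply: cvgD; last exact: cvg_harmonic.
      apply: cvgD; last exact: cvg_cst.
      apply: cvgMl_tmp; apply: cvgB; last exact: cvg_cst.
      by rewrite (rdotC _ z); exact: cvg_rdot.
    rewrite -[leRHS]addr0; apply: ler_cvg_to (@cvg_cst _ 0 _ \oo _) cv _.
    apply: nearW => n; have := hs n; have := IJ (t%:C *: x + s n).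
    rewrite /J fL (op_linear bM) !(rdotDl, rdotDr) !rdotZl !rdotZr
      (rdotC (M x) (M (s n))).
    by move: n.+1%:R^-1 => q; lra.
  have s0 := rdot_ge0 (M x).
  have p : 0 < [< M x, M x >] + 1 by lra.
  (* Nearly the minimiser in t; the added 1 keeps the denominator positive when M x = 0. The bound
     becomes 0 <= - d^2 (q + 2) / (q + 1)^2, so that d = 0. *)
  have := key (- d / ([< M x, M x >] + 1)).
  set q := [< M x, M x >] in s0 p *.
  have -> : 2 * (- d / (q + 1)) * d + (- d / (q + 1)) ^+ 2 * q =
     - (d ^+ 2 * (q + 2)) / (q + 1) ^+ 2 by field; lra.
  rewrite mulNr oppr_ge0 pmulr_lle0 ?invr_gt0 ?exprn_gt0//.
  rewrite pmulr_lle0; last lra.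
  rewrite le_eqVlt ltNge sqr_ge0 orbF sqrf_eq0 subr_eq0 => /eqP //.
exists z; split=> //.
  move=> w hw; apply: (cvg_unique (@Rhausdorff R) (cvg_rdot sz)).
  suff -> : (fun n => [< M (s n), w >]) = cst 0 by exact: cvg_cst.
  by apply/funext => n; exact: hw.
(* |z|^2 is the limit of <M s_n, z> = f s_n <= |M s_n| k. *)
have : nrm z ^+ 2 <= nrm z * k.
  rewrite -rdotxx; apply: (ler_cvg_to (cvg_rdot sz) (cvgMr_tmp (cvg_nrmr sz))).
  by apply: nearW => n; rewrite zf.
have := nrm_ge0 z; rewrite le_eqVlt => /predU1P[ <- //|z0].
by rewrite expr2 ler_pM2l.
Unshelve. all: by end_near.
Qed.

(** Riesz representation for each x solves M^* Z = b weakly, and uniqueness within the closed range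
    makes Z linear. The hypothesis with [c^*] encodes complex sesquilinearity of a form of which
    only the real part is kept. *)
Lemma douglas M (b : H -> H -> R) (p : H -> R) (k : R) : bounded_op M ->
  (forall a u v x, b (a%:C *: u + v) x = a * b u x + b v x) ->
  (forall c u x y, b u (c *: x + y) = b (c^* *: u) x + b u y) ->
  (forall x, 0 <= p x <= k * nrm x) ->
  (forall u x, b u x <= nrm (M u) * p x) ->
  exists Z, bounded_op Z /\ forall x,
    [/\ forall u, [< M u, Z x >] = b u x, range_closure M (Z x)
      & nrm (Z x) <= p x].
Proof.
move=> bM bl br pk bp.
have /choice[Z hZ] x : exists z,
    [/\ forall u, [< M u, z >] = b u x, range_closure M z & nrm z <= p x].
  have /andP[p0 _] := pk x.
  by apply: riesz_range => // u v w; rewrite bl.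
exists Z; split=> //; apply/bounded_opP; split.
  move=> c x y; have [hx cx _] := hZ x; have [hy cy _] := hZ y.
  have [hxy cxy _] := hZ (c *: x + y).
  apply: (range_closure_inj bM cxy).
    by apply: range_closureD => //; exact: range_closureZ.
  move=> u; rewrite hxy br -hx -hy rdotDr; congr (_ + _).
  rewrite (opZ bM) rdot_conj; congr [< _, _ *: _ >]; exact: conjCK.
exists k => x; have [_ _ h] := hZ x; apply: le_trans h _.
by have /andP[] := pk x.
Qed.

(** [douglas] with M = id and b u x = <T u, x> gives S; complex linearity of S restores the identity
    for [inner], so that [adjoint] does not fall back on its default. *)
Lemma adjointP T : bounded_op T ->
  bounded_op (adjoint T) /\ forall x y, [< T x, y >] = [< x, adjoint T y >].
Proof.
move=> bT; have [t t0 ht] := bounded_op_gt0 bT.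
have [S [bS hS]] : exists S, bounded_op S /\ forall x,
    [/\ forall u, [< u, S x >] = [< T u, x >], range_closure idfun (S x)
      & nrm (S x) <= t * nrm x].
  apply: (douglas (M := idfun) (k := t)) => [|a u v x|c u x y|x|u x].
  - exact: bounded_op_id.
  - by rewrite (op_linear bT) rdotDl rdotZl.
  - rewrite (opZ bT) rdotDr rdot_conj; congr ([< _, _ *: _ >] + _).
    by rewrite [RHS]conjCK.
  - by rewrite lexx andbT mulr_ge0 ?nrm_ge0// ltW.
  - apply: le_trans (ler_norm _) _; apply: le_trans (cauchy_schwarz _ _) _.
    by rewrite mulrA ler_wpM2r ?nrm_ge0// mulrC.
have e x y : [< T x, y >] = [< x, S y >] by have [-> ] := hS y.
have : [set S | bounded_op S /\ forall x y, inner (T x) y = inner x (S y)] S.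
  split=> // x y; rewrite !inner_rdot e; congr (_ +i* _).
  by rewrite e (opZ bS).
move=> /(xgetI (0 : H -> H))[? h]; split=> // x y.
by rewrite /rdot h.
Qed.

Lemma bounded_adjoint T : bounded_op T -> bounded_op (adjoint T).
Proof. by case/adjointP. Qed.

Lemma adjointE T x y : bounded_op T -> [< T x, y >] = [< x, adjoint T y >].
Proof. by case/adjointP. Qed.

Lemma adjointEr T x y : bounded_op T -> [< x, T y >] = [< adjoint T x, y >].
Proof. by move=> bT; rewrite rdotC adjointE// rdotC. Qed.

Lemma adjoint_eq S T : bounded_op T ->
  (forall x y, [< T x, y >] = [< x, S y >]) -> adjoint T = S.
Proof.
by move=> bT h; apply/funext => y; apply: rdot_inj => x; rewrite -adjointE.
Qed.

(** |S x|^2 = <T (S x), x> <= |S x| |x|. *)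
Lemma nrm_contr_adjoint S T :
  (forall x, nrm (T x) <= nrm x) -> (forall x y, [< T x, y >] = [< x, S y >]) ->
  forall x, nrm (S x) <= nrm x.
Proof.
move=> cT h x; have : nrm (S x) ^+ 2 <= nrm (S x) * nrm x.
  rewrite -rdotxx -h; apply: le_trans (ler_norm _) _.
  by apply: le_trans (cauchy_schwarz _ _) _; rewrite ler_wpM2r ?nrm_ge0.
have := nrm_ge0 (S x); rewrite le_eqVlt => /predU1P[ <- _|z0];
  first exact: nrm_ge0.
by rewrite expr2 ler_pM2l.
Qed.

Lemma eq_rdot_isometric S T : bounded_op S -> bounded_op T ->
  (forall x, nrm (S x) = nrm (T x)) -> forall x y,
    [< S x, S y >] = [< T x, T y >].
Proof.
move=> bS bT h x y; have := h (x + y); have := h x; have := h y.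
move=> /(congr1 (fun r => r ^+ 2)) + /(congr1 (fun r => r ^+ 2)).
move=> + + /(congr1 (fun r => r ^+ 2)).
rewrite -!rdotxx (opD bS) (opD bT) !rdotDl !rdotDr (rdotC (S y) (S x)).
by rewrite (rdotC (T y) (T x)); lra.
Qed.

(** P x represents u |-> <M u, x> in the closed range, so x - P x is orthogonal to the range of M: P
    is the orthogonal projection onto its closure. *)
Lemma range_projection M : bounded_op M -> exists P, [/\ bounded_op P,
  forall x y, [< P x, y >] = [< x, P y >],
  forall x, range_closure M (P x),
  forall x, range_closure M x -> P x = x &
  forall x, (forall u, [< M u, x >] = 0) -> P x = 0].
Proof.
move=> bM.
have [P [bP hP]] : exists P, bounded_op P /\ forall x,
    [/\ forall u, [< M u, P x >] = [< M u, x >], range_closure M (P x)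
      & nrm (P x) <= nrm x].
  apply: (douglas (k := 1)) => // [a u v x|c u x y|x|u x].
  - by rewrite (op_linear bM) rdotDl rdotZl.
  - rewrite (opZ bM) rdotDr rdot_conj; congr ([< _, _ *: _ >] + _).
    by rewrite [RHS]conjCK.
  - by rewrite mul1r lexx nrm_ge0.
  - by apply: le_trans (ler_norm _) (cauchy_schwarz _ _).
have PP x y : [< P x, P y >] = [< P x, y >].
  have [_ cx _] := hP x; have [hy _ _] := hP y.
  apply/eqP; rewrite -subr_eq0 -rdotBr cx// => u.
  by rewrite rdotBr hy subrr.
exists P; split=> // [x y|x|x cx|x hx].
- by rewrite -PP rdotC PP rdotC.
- by have [] := hP x.
- by have [hx cPx _] := hP x; apply: (range_closure_inj bM).
- have [hPx cPx _] := hP x; apply: (range_closure_inj bM) => // [|u].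
    by move=> w _; rewrite rdot0l.
  by rewrite hPx hx rdot0r.
Qed.

(** C is the adjoint of the solution D of N^* D = T^*. As D maps into the closed range of N, C
    vanishes on the orthogonal complement of that range. *)
Lemma contraction_factor N T : bounded_op N -> bounded_op T ->
  (forall x, nrm (T x) <= nrm (N x)) -> exists C, [/\ bounded_op C,
  forall x, nrm (C x) <= nrm x, forall x, C (N x) = T x &
  forall x, range_closure N (adjoint C x)].
Proof.
move=> bN bT le.
have [D [bD hD]] : exists D, bounded_op D /\ forall x,
    [/\ forall u, [< N u, D x >] = [< T u, x >], range_closure N (D x)
      & nrm (D x) <= nrm x].
  apply: (douglas (k := 1)) => // [a u v x|c u x y|x|u x].
  - by rewrite (op_linear bT) rdotDl rdotZl.
  - rewrite (opZ bT) rdotDr rdot_conj; congr ([< _, _ *: _ >] + _).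
    by rewrite [RHS]conjCK.
  - by rewrite mul1r lexx nrm_ge0.
  - apply: le_trans (ler_norm _) _; apply: le_trans (cauchy_schwarz _ _) _.
    by rewrite ler_wpM2r ?nrm_ge0.
have bC := bounded_adjoint bD.
have aC : adjoint (adjoint D) = D.
  by apply: adjoint_eq => // x y; rewrite -adjointEr.
exists (adjoint D); split=> // [x|x|x].
- apply: (nrm_contr_adjoint (T := D)) => [y|y z]; last exact: adjointE.
  by have [] := hD y.
- apply: rdot_inj => y; rewrite -adjointE// rdotC.
  by have [-> _ _] := hD y; rewrite rdotC.
- by rewrite aC; have [] := hD x.
Qed.

(** * Square roots of positive operators *)

(** Positivity of T at k x - T x: the form expands to k^2 <T x, x> - 2 k |T x|^2 + <T (T x), T x>,
    whose last term is at most k |T x|^2. *)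
Lemma positive_nrm T (k : R) : positive_op T -> 0 < k ->
  (forall x, nrm (T x) <= k * nrm x) ->
  forall x, nrm (T x) ^+ 2 <= k * [< T x, x >].
Proof.
move=> /positive_opP[bT sT pT] k0 hk x.
have := pT (k%:C *: x - T x); rewrite (opB bT) (opZ bT).
rewrite rdotBl !rdotBr !rdotZl !rdotZr (sT (T x) x) rdotxx => h.
have : [< T (T x), T x >] <= k * nrm (T x) ^+ 2.
  apply: le_trans (ler_norm _) _; apply: le_trans (cauchy_schwarz _ _) _.
  by have := hk (T x); have := nrm_ge0 (T x); nra.
move=> h2; rewrite -(ler_pM2l k0); lra.
Qed.

(* Otherwise B - G has approximate eigenvectors x for the least point -m < 0 of
   its numerical range, and G x ~ B x + m x is strictly longer than B x. *)
Lemma loewner B G : positive_op B -> bounded_op G ->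
  (forall x y, [< G x, y >] = [< x, G y >]) ->
  (forall x, nrm (G x) <= nrm (B x)) -> forall x, [< G x, x >] <= [< B x, x >].
Proof.
move=> pB bG sG le; have [bB sB rB] := (positive_opP B).1 pB.
have [g g0 hg] := bounded_op_gt0 bG.
have [b b0 hb] := bounded_op_gt0 bB.
(* The infimum of E is the least m >= 0 with G - B <= m; the claim is that it vanishes. *)
pose E : set R := [set m | 0 <= m /\
  forall x, [< G x, x >] - [< B x, x >] <= m * nrm x ^+ 2].
have hE : has_inf E.
  split; last by exists 0 => m [].
  exists g; split=> [|x]; first exact: ltW.
  have := rB x; have : [< G x, x >] <= g * nrm x ^+ 2; last by lra.
  apply: le_trans (ler_norm _) _; apply: le_trans (cauchy_schwarz _ _) _.
  by rewrite expr2 mulrA ler_wpM2r// nrm_ge0.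
pose m : R := inf E.
have m0 : 0 <= m by apply: lb_le_inf => [|e []//]; case: hE.
have hm x : [< G x, x >] - [< B x, x >] <= m * nrm x ^+ 2.
  apply/ler_addgt0Pr => e e0.
  have p : 0 < nrm x ^+ 2 + 1 by have := sqr_ge0 (nrm x); lra.
  have q : 0 < e / (nrm x ^+ 2 + 1) by rewrite divr_gt0.
  have [e' [_ /(_ x) h] he'] := inf_adherent q hE.
  apply: le_trans h _.
  apply: le_trans (_ : (m + e / (nrm x ^+ 2 + 1)) * nrm x ^+ 2 <= _).
    by rewrite ler_wpM2r ?sqr_ge0// ltW.
  rewrite mulrDl lerD2l mulrAC ler_pdivrMr//; nra.
move: m0; rewrite le_eqVlt => /predU1P[m0 x|m0].
  by have := hm x; rewrite -m0 mul0r subr_le0.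
exfalso.
pose T x := B x + m%:C *: x - G x.
have bT : bounded_op T.
  apply: bounded_opB bG; apply: bounded_opD bB _.
  exact: bounded_opZ bounded_op_id.
have pT : positive_op T.
  apply/positive_opP; split=> // [x y|x].
    by rewrite /T !(rdotDl, rdotDr, rdotNl, rdotNr) rdotZl rdotZr sB sG.
  rewrite /T !(rdotDl, rdotNl) rdotZl rdotxx; have := hm x; lra.
have [k k0 hk] := bounded_op_gt0 bT.
pose l : R := b + m.
have l0 : 0 < l by rewrite addr_gt0.
have hl x : nrm (B x + m%:C *: x) <= l * nrm x.
  apply: le_trans (nrmD _ _) _; rewrite nrmZ gtr0_norm//.
  by rewrite mulrDl lerD2r.
(* d <= m keeps m - d nonnegative, so that m - d is not in E and some x exceeds it. The other bound
   gives 4 k l^2 d <= m^4 / 2, which leads to m^4 |x|^2 <= m^4 |x|^2 / 2. *)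
pose d : R := Num.min m (m ^+ 4 / (8 * k * l ^+ 2)).
have q0 : 0 < 8 * k * l ^+ 2 by rewrite !mulr_gt0// exprn_gt0.
have d0 : 0 < d by rewrite lt_min m0 divr_gt0// exprn_gt0.
have dm : d <= m by rewrite ge_min lexx.
have dk : d * (8 * k * l ^+ 2) <= m ^+ 4.
  by rewrite -ler_pdivlMr// ge_min lexx orbT.
have [x hx] : exists x, (m - d) * nrm x ^+ 2 < [< G x, x >] - [< B x, x >].
  apply: contrapT => hN; have : E (m - d).
    split=> [|x]; first by rewrite subr_ge0.
    by rewrite leNgt; apply/negP => h; apply: hN; exists x.
  by move=> /(ge_inf hE.2); rewrite -/m; lra.
have x0 : 0 < nrm x.
  apply: nrm_gt0 => x0; move: hx.
  by rewrite x0 (op0 bG) (op0 bB) !rdot0l nrm0 expr0n/= mulr0 subr0 ltxx.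
have Tx : [< T x, x >] <= d * nrm x ^+ 2.
  by rewrite /T !(rdotDl, rdotNl) rdotZl rdotxx; lra.
have TT : nrm (T x) ^+ 2 <= k * (d * nrm x ^+ 2).
  by apply: le_trans (positive_nrm pT k0 hk x) _; rewrite ler_pM2l.
pose y := B x + m%:C *: x.
have Gy : G x = y - T x by rewrite /T opprB addrC subrK.
(* Compare |y - T x|^2 = |G x|^2 <= |B x|^2 with |y|^2 >= |B x|^2 + m^2 |x|^2. *)
have h1 : m ^+ 2 * nrm x ^+ 2 <= 2 * [< y, T x >].
  have : [< G x, G x >] <= [< B x, B x >] by rewrite -nrm_le.
  have yy : [< y, y >] = [< B x, B x >] + 2 * m * [< B x, x >] +
    m ^+ 2 * nrm x ^+ 2.
    by rewrite /y !(rdotDl, rdotDr) !rdotZl !rdotZr (rdotC x (B x)) (rdotxx x);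
      ring.
  rewrite Gy rdotBB yy.
  have : 0 <= 2 * m * [< B x, x >] by rewrite !mulr_ge0// ltW.
  have := rdot_ge0 (T x); lra.
have h2 : [< y, T x >] <= l * nrm x * nrm (T x).
  apply: le_trans (ler_norm _) _; apply: le_trans (cauchy_schwarz _ _) _.
  by rewrite ler_wpM2r ?nrm_ge0// hl.
have h3 : m ^+ 2 * nrm x <= 2 * l * nrm (T x).
  by rewrite -(ler_pM2l x0); lra.
have h4 : (m ^+ 2 * nrm x) ^+ 2 <= (2 * l * nrm (T x)) ^+ 2.
  have u0 : 0 <= m ^+ 2 * nrm x by rewrite mulr_ge0 ?sqr_ge0// ltW.
  by rewrite ler_sqr ?nnegrE//; apply: le_trans u0 h3.
have h5 : (2 * l) ^+ 2 * nrm (T x) ^+ 2 <=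
  (2 * l) ^+ 2 * (k * (d * nrm x ^+ 2)).
  by rewrite ler_wpM2l// sqr_ge0.
have x2 : 0 < nrm x ^+ 2 by rewrite exprn_gt0.
have h6 : m ^+ 4 * nrm x ^+ 2 <= 2^-1 * m ^+ 4 * nrm x ^+ 2.
  apply: le_trans (_ : 4 * k * l ^+ 2 * d * nrm x ^+ 2 <= _); first lra.
  by rewrite ler_wpM2r ?sqr_ge0//; lra.
have m4 : 0 < m ^+ 4 by rewrite exprn_gt0.
by move: h6; rewrite ler_pM2r//; lra.
Qed.

(* Fixed-point iteration for Y = 1 - sqrt(1 - D):
   (1 - Y)^2 = 1 - D means Y = (D + Y^2) / 2. *)
Fixpoint sqrt_step D (n : nat) : H -> H :=
  if n is n'.+1 then
    (2^-1 : R)%:C *: (D + (sqrt_step D n' \o sqrt_step D n'))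
  else 0.

(* [sqrt_step] for the scalar D = 1: it dominates the general case in norm. *)
Fixpoint sqrt_rate (n : nat) : R :=
  if n is n'.+1 then 2^-1 * (1 + sqrt_rate n' ^+ 2) else 0.

Lemma sqrt_stepS D n x : sqrt_step D n.+1 x =
  (2^-1 : R)%:C *: (D x + sqrt_step D n (sqrt_step D n x)).
Proof. by []. Qed.

Lemma sqrt_rate_ge0 n : 0 <= sqrt_rate n.
Proof. by case: n => //= n; have := sqr_ge0 (sqrt_rate n); lra. Qed.

Lemma sqrt_rate_le1 n : sqrt_rate n <= 1.
Proof. by elim: n => //= n ih; have := sqrt_rate_ge0 n; nra. Qed.

Lemma sqrt_rateS n : sqrt_rate n <= sqrt_rate n.+1.
Proof. by rewrite /=; have := sqr_ge0 (sqrt_rate n - 1); nra. Qed.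

Lemma sqrt_rate_le n m : (n <= m)%N -> sqrt_rate n <= sqrt_rate m.
Proof.
by elim: m n => [[]//|m ih] n; rewrite leq_eqVlt => /predU1P[->//|/ih h];
  apply: le_trans h (sqrt_rateS m).
Qed.

Lemma sqrt_rate_cauchy e : 0 < e -> exists N : nat, forall m n : nat,
  (N <= m)%N -> (N <= n)%N -> `|sqrt_rate m - sqrt_rate n| < e.
Proof.
move=> e0; have hs : has_sup (range sqrt_rate).
  split; first by exists (sqrt_rate 0%N), 0%N.
  by exists 1 => _ [n _ <-]; exact: sqrt_rate_le1.
have [_ [N _ <-] hN] := sup_adherent e0 hs.
have le n : sqrt_rate n <= sup (range sqrt_rate).
  by apply: ub_le_sup; [exact: hs.2|exists n].
exists N => m n /sqrt_rate_le Nm /sqrt_rate_le Nn.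
by rewrite ltr_norml; have := le m; have := le n; move=> *; apply/andP; split;
  lra.
Qed.

(** * Convergence of the square root iteration *)

Section Iteration.
Context D (bD : bounded_op D) (sD : forall x y, [< D x, y >] = [< x, D y >])
  (cD : forall x, nrm (D x) <= nrm x).

Lemma bounded_sqrt_step n : bounded_op (sqrt_step D n).
Proof.
elim: n => [|n ih] /=; last first.
  exact/bounded_opZ/bounded_opD/bounded_op_comp.
apply/bounded_opP; split; first by move=> c x y;
  rewrite -[RHS]/(c *: 0 + 0) scaler0 addr0.
by exists 0 => x; rewrite nrm0 mul0r.
Qed.

Lemma sqrt_step_sym n x y : [< sqrt_step D n x, y >] = [< x, sqrt_step D n y >].
Proof.
elim: n x y => [|n ih] x y; first by rewrite rdot0l rdot0r.
by rewrite !sqrt_stepS rdotZl rdotZr rdotDl rdotDr sD !ih.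
Qed.

Lemma nrm_sqrt_step n x : nrm (sqrt_step D n x) <= sqrt_rate n * nrm x.
Proof.
elim: n x => [|n ih] x; first by rewrite nrm0 mul0r.
rewrite sqrt_stepS nrmZ gtr0_norm//= -mulrA ler_wpM2l//.
apply: le_trans (nrmD _ _) _; rewrite mulrDl mul1r lerD//.
apply: le_trans (ih _) _; rewrite expr2 -mulrA.
by rewrite ler_wpM2l// sqrt_rate_ge0.
Qed.

(** Y_{n+1}^2 - Y_n^2 = Y_{n+1} (Y_{n+1} - Y_n) + (Y_{n+1} - Y_n) Y_n; the same splitting of the
    scalar squares bounds the two terms. *)
Lemma nrm_sqrt_stepS n x : nrm (sqrt_step D n.+1 x - sqrt_step D n x) <=
  (sqrt_rate n.+1 - sqrt_rate n) * nrm x.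
Proof.
elim: n x => [|n ih] x.
  rewrite !subr0; exact: nrm_sqrt_step.
have bn := bounded_sqrt_step n; have bn1 := bounded_sqrt_step n.+1.
rewrite {1}sqrt_stepS [sqrt_step D n.+1 x in X in _ - X]sqrt_stepS.
rewrite -scalerBr nrmZ gtr0_norm// opprD addrACA subrr add0r.
rewrite -(subrK (sqrt_step D n.+1 (sqrt_step D n x))
  (sqrt_step D n.+1 (sqrt_step D n.+1 x))) -addrA -(opB bn1).
have h1 := nrm_sqrt_step n.+1 (sqrt_step D n.+1 x - sqrt_step D n x).
have h2 := ih (sqrt_step D n x); have h3 := nrm_sqrt_step n x.
have h4 := ih x; have r1 := sqrt_rate_ge0 n.+1;
have rr := sqrt_rateS n.
have -> : sqrt_rate n.+2 - sqrt_rate n.+1 =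
  2^-1 * (sqrt_rate n.+1 * (sqrt_rate n.+1 - sqrt_rate n)
    + (sqrt_rate n.+1 - sqrt_rate n) * sqrt_rate n).
  by rewrite /=; field.
rewrite -mulrA ler_wpM2l//; apply: le_trans (nrmD _ _) _; rewrite mulrDl.
apply: lerD.
  by apply: le_trans h1 _; rewrite -mulrA ler_wpM2l.
by apply: le_trans h2 _; rewrite -mulrA ler_wpM2l// subr_ge0.
Qed.

Lemma nrm_sqrt_stepB m n x : (n <= m)%N ->
  nrm (sqrt_step D m x - sqrt_step D n x) <=
    (sqrt_rate m - sqrt_rate n) * nrm x.
Proof.
elim: m => [|m ih]; first by rewrite leqn0 => /eqP ->;
  rewrite !subrr nrm0 mul0r.
rewrite leq_eqVlt => /predU1P[->|/ih h]; first by rewrite !subrr nrm0 mul0r.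
rewrite -(subrK (sqrt_step D m x) (sqrt_step D m.+1 x)) -addrA.
apply: le_trans (nrmD _ _) _; have := nrm_sqrt_stepS m x; lra.
Qed.

Lemma sqrt_step_cvg : exists Y : H -> H, forall x,
  (fun n => sqrt_step D n x) @ \oo --> Y x.
Proof.
suff /choice[Y hY] x : exists y : H, (fun n => sqrt_step D n x) @ \oo --> y
  by exists Y.
apply: nrm_cauchy_cvg => e e0.
have p : 0 < nrm x + 1 by have := nrm_ge0 x; lra.
have [N hN] := sqrt_rate_cauchy (divr_gt0 e0 p).
exists N => m n Nm Nn; have := hN _ _ Nm Nn; rewrite ltr_pdivlMr//.
apply: le_lt_trans; apply: le_trans
  (_ : `|sqrt_rate m - sqrt_rate n| * nrm x <= _).
  have [nm|/ltnW mn] := leqP n m.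
    by rewrite ger0_norm ?subr_ge0 ?sqrt_rate_le//; exact: nrm_sqrt_stepB.
  by rewrite nrmBC distrC ger0_norm ?subr_ge0 ?sqrt_rate_le//;
    exact: nrm_sqrt_stepB.
by rewrite ler_wpM2l//; lra.
Qed.

Lemma cvg_hilbert_unique (s : nat -> H) x y : s @ \oo --> x -> s @ \oo --> y ->
  x = y.
Proof. by apply: cvg_unique; exact: norm_hausdorff. Qed.

Lemma cvg_op (s : nat -> H) x T : bounded_op T ->
  s @ \oo --> x -> (fun n => T (s n)) @ \oo --> T x.
Proof.
move=> bT /cvg_nrm/cvgrPdist_le h; apply: nrm_cvg.
have [t t0 ht] := bounded_op_gt0 bT; apply/cvgrPdist_le => e e0.
have := h _ (divr_gt0 e0 t0); apply: filterS => n.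
rewrite !sub0r !normrN !ger0_norm ?nrm_ge0// -(opB bT) ler_pdivlMr// => h1.
by apply: le_trans (ht _) _; rewrite mulrC.
Qed.

(** The strong limit satisfies the fixed-point equation 2 Y = D + Y^2. Each step is a polynomial in
    D, so whatever commutes with D commutes with the limit. *)
Lemma sqrt_step_limit : exists Y, [/\ bounded_op Y,
  forall x, nrm (Y x) <= nrm x,
  forall x y, [< Y x, y >] = [< x, Y y >],
  forall x, D x + Y (Y x) = (2 : R)%:C *: Y x &
  forall T, bounded_op T -> (forall x, T (D x) = D (T x)) ->
    forall x, T (Y x) = Y (T x)].
Proof.
have [Y hY] := sqrt_step_cvg; exists Y.
have cY x : nrm (Y x) <= nrm x.
  apply: (ler_cvg_to (cvg_nrmr (hY x)) (@cvg_cst _ (nrm x) _ \oo _)).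
  apply: nearW => n; apply: le_trans (nrm_sqrt_step n x) _.
  by rewrite ler_piMl ?nrm_ge0// sqrt_rate_le1.
have bY : bounded_op Y.
  apply/bounded_opP; split; last by exists 1 => x; rewrite mul1r.
  move=> c x y; apply: cvg_hilbert_unique (hY _) _.
  under eq_fun do rewrite (op_linear (bounded_sqrt_step _)).
  by apply: cvgD (hY y); exact: cvgZl_tmp (hY x).
split=> // [x y|x|T bT cT x].
- apply: (cvg_unique (@Rhausdorff R) (cvg_rdot (hY x))).
  suff -> : (fun n => [< sqrt_step D n x, y >]) = fun n =>
    [< sqrt_step D n y, x >].
    by rewrite (rdotC x); exact: cvg_rdot (hY y).
  by apply/funext => n; rewrite sqrt_step_sym rdotC.
(* The steps Y_n are contractions, so |Y_n Y_n x - Y Y x| <= |Y_n x - Y x| + |Y_n (Y x) - Y (Y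
   x)|. *)
- have YY : (fun n => sqrt_step D n (sqrt_step D n x)) @ \oo --> Y (Y x).
    apply: nrm_cvg; apply: (@squeeze_cvgr _ _ _ _ (fun=> 0)
      (fun n => nrm (sqrt_step D n x - Y x) +
        nrm (sqrt_step D n (Y x) - Y (Y x)))).
    - apply: nearW => n; rewrite nrm_ge0/=.
      rewrite -(subrK (sqrt_step D n (Y x)) (sqrt_step D n (sqrt_step D n x)))
        -addrA.
      apply: le_trans (nrmD _ _) _; rewrite lerD2r -(opB (bounded_sqrt_step n)).
      apply: le_trans (nrm_sqrt_step _ _) _.
      by rewrite ler_piMl ?nrm_ge0// sqrt_rate_le1.
    - exact: cvg_cst.
    - rewrite -[0 in X in _ --> X](addr0 0); apply: cvgD; exact: cvg_nrm.
  have : (fun n => sqrt_step D n.+1 x) @ \oo -->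
    (2^-1 : R)%:C *: (D x + Y (Y x)).
    apply: cvgZl_tmp; apply: cvgD YY; exact: cvg_cst.
  rewrite (@cvg_shiftS _ (fun n => sqrt_step D n x)) =>
    /(cvg_hilbert_unique (hY x)) e.
  by rewrite [in RHS]e scalerA -rmorphM/= divff ?pnatr_eq0// scale1r.
- apply: (cvg_hilbert_unique (cvg_op bT (hY x))).
  suff -> : (fun n => T (sqrt_step D n x)) = fun n => sqrt_step D n (T x).
    exact: hY.
  apply/funext => n; elim: n x => [|n ih] x; first exact: op0.
  by rewrite !sqrt_stepS (opZ bT) (opD bT) cT !ih.
Qed.

End Iteration.

(** For a norm bound k of A, D = 1 - A / k is a contraction, and S = sqrt k (1 - Y) with (1 - Y)^2 =
    1 - D = A / k. The commutation clause serves to make |G| commute with G in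
    [positive_part_projection]. *)
Lemma sqrt_exists A : positive_op A -> exists S, [/\ positive_op S,
  forall x, S (S x) = A x &
  forall T, bounded_op T -> (forall x, T (A x) = A (T x)) ->
    forall x, T (S x) = S (T x)].
Proof.
move=> pA; have [bA sA rA] := (positive_opP A).1 pA.
have [k k0 hk] := bounded_op_gt0 bA; have hA := positive_nrm pA k0 hk.
pose D : H -> H := idfun - k^-1%:C *: A.
have DE x : D x = x - k^-1%:C *: A x by [].
have bD : bounded_op D.
  by apply: bounded_opB; [exact: bounded_op_id|exact: bounded_opZ].
have sD x y : [< D x, y >] = [< x, D y >].
  by rewrite !DE rdotBl rdotBr rdotZl rdotZr sA.
(* |D x|^2 = |x|^2 - (2 / k) <A x, x> + |A x|^2 / k^2, where |A x|^2 <= k <A x, x> by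
   [positive_nrm]. *)
have cD x : nrm (D x) <= nrm x.
  rewrite nrm_le DE rdotBB rdotZl !rdotZr rdotxx (rdotC x) rdotxx.
  have := rA x; have := hA x.
  rewrite -(ler_pM2l (_ : 0 < k^-1 ^+ 2)) ?exprn_gt0 ?invr_gt0// => h1 h2.
  have e : k^-1 ^+ 2 * (k * [< A x, x >]) = k^-1 * [< A x, x >].
    by rewrite expr2 -mulrA mulKf// gt_eqF.
  have p : 0 <= k^-1 * [< A x, x >] by rewrite mulr_ge0// invr_ge0 ltW.
  lra.
have [Y [bY cY sY YE YT]] := sqrt_step_limit bD sD cD.
pose S : H -> H := (Num.sqrt k)%:C *: (idfun - Y).
have SE x : S x = (Num.sqrt k)%:C *: (x - Y x) by [].
have bS : bounded_op S.
  by apply/bounded_opZ/bounded_opB => //; exact: bounded_op_id.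
exists S; split=> [|x|T bT cT x].
- apply/positive_opP; split=> // [x y|x].
    by rewrite !SE rdotZl rdotZr rdotBl rdotBr sY.
  rewrite SE rdotZl mulr_ge0 ?sqrtr_ge0// rdotBl subr_ge0 rdotxx.
  apply: le_trans (ler_norm _) _; apply: le_trans (cauchy_schwarz _ _) _.
  by rewrite expr2 ler_wpM2r ?nrm_ge0.
- have YYx : Y (Y x) = (2 : R)%:C *: Y x - D x by rewrite -YE addrC addKr.
  rewrite !SE (opZ bY) (opB bY) -scalerBr scalerA -rmorphM/= -expr2 sqr_sqrtr
    ?ltW//.
  rewrite YYx DE.
  have -> : x - Y x - (Y x - ((2 : R)%:C *: Y x - (x - k^-1%:C *: A x))) =
      k^-1%:C *: A x.
    by apply: rdot_inj => z; rewrite !(rdotDr, rdotNr, rdotZr); ring.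
  by rewrite scalerA -rmorphM/= divff ?gt_eqF// scale1r.
- rewrite !SE (opZ bT) (opB bT) YT// => y.
  by rewrite !DE (opB bT) (opZ bT) cT.
Qed.

Lemma op_sqrtP A : positive_op A ->
  positive_op (op_sqrt A) /\ forall x, op_sqrt A (op_sqrt A x) = A x.
Proof.
move=> pA; have [S [pS SS _]] := sqrt_exists pA.
have : [set S | positive_op S /\ S \o S = A] S by split=> //; exact/funext.
by move=> /(xgetI (0 : H -> H))[? h]; split=> // x; rewrite -[in RHS]h.
Qed.

(** * Isometric polar decomposition *)

Lemma positive_eq0 T x : positive_op T -> [< T x, x >] = 0 -> T x = 0.
Proof.
move=> pT h; have [bT _ _] := (positive_opP T).1 pT.
have [k k0 hk] := bounded_op_gt0 bT.
apply: rdot_le0; rewrite rdotxx.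
by have := positive_nrm pT k0 hk x; rewrite h mulr0.
Qed.

(** Q is the square root of T^* T, so that |Q x|^2 = <T^* T x, x>. *)
Lemma modulus_exists T : bounded_op T ->
  exists2 Q, positive_op Q & forall x, nrm (Q x) = nrm (T x).
Proof.
move=> bT; have bT' := bounded_adjoint bT.
have pG : positive_op (adjoint T \o T).
  apply/positive_opP; split=> [|x y|x]; first exact: bounded_op_comp.
    by rewrite /= -adjointEr// -adjointE.
  by rewrite /= -adjointEr// rdot_ge0.
have [pQ hQ] := op_sqrtP pG; have [_ sQ _] := (positive_opP _).1 pQ.
exists (op_sqrt (adjoint T \o T)) => // x.
apply/eqP; rewrite -(eqrXn2 (n := 2))// ?nrm_ge0// -!rdotxx.
by rewrite -sQ hQ/= -adjointEr.
Qed.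

(* The polar decomposition Y = U |Y|, with U extended from the closure of the
   range of |Y| to an isometry by the isometric polar part of L on ker Y. *)
Lemma isometric_polar Y L : bounded_op Y -> bounded_op L ->
  (forall x, adjoint Y (L x) = 0) ->
  (forall x, Y x = 0 -> L x = 0 -> x = 0) ->
  exists U, isometry_op U /\
    forall x, nrm (adjoint Y x) = nrm (Y (adjoint U x)).
Proof.
move=> bY bL YL inj.
have [Q pQ nQ] := modulus_exists bY.
have [bQ sQ _] := (positive_opP Q).1 pQ.
have [p [bp sp cp fp kp]] := range_projection bQ.
have pp x : p (p x) = p x by exact: fp.
have pQx x : p (Q x) = Q x by apply: fp; exact: range_closure_image.
(* 1 - p projects onto ker Q = ker Y, so L' is L cut down to ker Y. *)
pose L' : H -> H := L \o (idfun - p).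
have L'E x : L' x = L (x - p x) by [].
have bL' : bounded_op L'.
  by apply: bounded_op_comp => //; apply: bounded_opB => //;
    exact: bounded_op_id.
have [Q' pQ' nQ'] := modulus_exists bL'.
have [bQ' sQ' _] := (positive_opP Q').1 pQ'.
have Q'p x : Q' (p x) = 0.
  by apply: nrm_eq0; rewrite nQ' L'E pp subrr (op0 bL) nrm0.
have QQ' x y : [< Q x, Q' y >] = 0 by rewrite -sQ' -pQx Q'p rdot0l.
have YL' x y : [< Y x, L' y >] = 0 by rewrite adjointE// YL rdot0r.
(* Q and Q' have orthogonal ranges, and so do Y and L' since Y^* L = 0; hence |T x| = |N x|. N is
   injective and symmetric, so its range is dense and U N = T determines an isometry U. *)
pose N : H -> H := Q + Q'; pose T : H -> H := Y + L'.
have NE x : N x = Q x + Q' x by [].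
have TE x : T x = Y x + L' x by [].
have bN : bounded_op N by exact: bounded_opD.
have bT : bounded_op T by exact: bounded_opD.
have N2 x : nrm (N x) ^+ 2 = nrm (Y x) ^+ 2 + nrm (L' x) ^+ 2.
  rewrite -rdotxx NE rdotDl !rdotDr QQ' (rdotC (Q' x)) QQ' !rdotxx nQ nQ'; ring.
have TN x : nrm (T x) = nrm (N x).
  apply/eqP; rewrite -(eqrXn2 (n := 2))// ?nrm_ge0// N2 -!rdotxx TE.
  by rewrite rdotDl !rdotDr YL' (rdotC (L' x) (Y x)) YL' addr0 add0r.
have sN x y : [< N x, y >] = [< x, N y >].
  by rewrite !NE rdotDl rdotDr sQ sQ'.
have injN x : N x = 0 -> x = 0.
  move=> Nx; have := N2 x; rewrite Nx nrm0 expr0n/= => /esym/eqP.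
  rewrite paddr_eq0 ?sqr_ge0// !sqrf_eq0 => /andP[/eqP Yx /eqP/nrm_eq0 L'x].
  have px : p x = 0.
    apply: kp => u; rewrite sQ (_ : Q x = 0) ?rdot0r//.
    by apply: nrm_eq0; rewrite nQ.
  by apply: inj; [exact: nrm_eq0|rewrite -L'x L'E px subr0].
have cN x : range_closure N x.
  move=> w hw; rewrite (injN w) ?rdot0r//.
  by apply: rdot_inj => u; rewrite -sN hw rdot0r.
have NT x : nrm (T x) <= nrm (N x) by rewrite TN.
have [U [bU _ UN _]] := contraction_factor bN bT NT.
have UUN x : adjoint U (U (N x)) = N x.
  apply: (range_closure_inj bN) => // u.
  by rewrite -adjointE// !UN; exact: eq_rdot_isometric.
have UU x : adjoint U (U x) = x.
  apply: (range_closure_inj bN) => // u.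
  by rewrite -adjointE// adjointEr// UUN.
have Qp x : Q (p x) = Q x.
  by apply: rdot_inj => u; rewrite -!sQ -sp pQx.
have Yp x : Y (p x) = Y x.
  apply/eqP; rewrite -subr_eq0 -(opB bY); apply/eqP/nrm_eq0.
  by rewrite -nQ (opB bQ) Qp subrr nrm0.
have UQ x : U (Q x) = Y x.
  have <- : N (p x) = Q x by rewrite NE Q'p addr0 Qp.
  by rewrite UN TE L'E pp subrr (op0 bL) addr0 Yp.
exists U; split=> [|x]; first by split=> //; exact/funext.
have -> : adjoint Y x = Q (adjoint U x).
  by apply: rdot_inj => u; rewrite -adjointE// -UQ adjointE// sQ.
by rewrite nQ.
Qed.

(** * Domination of the real part *)

(** B = |G| commutes with G, so E = B + G and F = B - G are twice the positive and negative parts of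
    G, and F E = 0. P projects onto the closed range of E; hence F P = 0 and <G P x, P x> = <E x, x>
    / 2. *)
Lemma positive_part_projection G : bounded_op G ->
  (forall x y, [< G x, y >] = [< x, G y >]) ->
  exists P, [/\ bounded_op P, forall x y, [< P x, y >] = [< x, P y >],
    forall x, P (P x) = P x, forall x, [< G x, x >] <= [< G (P x), P x >] &
    forall x, [< G (P x), P x >] <= 0 -> P x = 0].
Proof.
move=> bG sG.
have pGG : positive_op (G \o G).
  apply/positive_opP; split=> [|x y|x]; first exact: bounded_op_comp.
    by rewrite /= !sG.
  by rewrite /= sG rdot_ge0.
have [B [pB BB cB]] := sqrt_exists pGG; have [bB sB _] := (positive_opP B).1 pB.
have GB x : G (B x) = B (G x) by apply: cB.
have BG x : nrm (G x) <= nrm (B x) by rewrite nrm_le -sB BB /= (sG (G x)).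
have GleB := loewner pB bG sG BG.
have NleB x : - [< G x, x >] <= [< B x, x >].
  rewrite -rdotNl; apply: (loewner pB (bounded_opN bG)) => [u v|u].
    by rewrite /= rdotNl sG -rdotNr.
  by rewrite nrmN.
pose E : H -> H := B + G; pose F : H -> H := B - G.
have EE x : E x = B x + G x by [].
have FE x : F x = B x - G x by [].
have bE : bounded_op E by exact: bounded_opD.
have sE x y : [< E x, y >] = [< x, E y >] by rewrite !EE rdotDl rdotDr sB sG.
have sF x y : [< F x, y >] = [< x, F y >] by rewrite !FE rdotBl rdotBr sB sG.
have pE : positive_op E.
  by apply/positive_opP; split=> // x; rewrite EE rdotDl; have := NleB x; lra.
have F0 x : 0 <= [< F x, x >] by rewrite FE rdotBl subr_ge0.
have FEx x : F (E x) = 0.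
  by rewrite FE EE (opD bB) (opD bG) BB GB /= [X in _ - X]addrC subrr.
have [P [bP sP cP fP kP]] := range_projection bE.
have PEx x : P (E x) = E x by apply: fP; exact: range_closure_image.
have EP x : E (P x) = E x by apply: rdot_inj => u; rewrite -!sE -sP PEx.
have PF x : P (F x) = 0 by apply: kP => u; rewrite -sF FEx rdot0l.
have FP x : F (P x) = 0 by apply: rdot_inj => u;
  rewrite -sF -sP PF rdot0l rdot0r.
have GP x : [< G (P x), P x >] = 2^-1 * [< E x, x >].
  have : [< F (P x), P x >] = 0 by rewrite FP rdot0l.
  have : [< E (P x), P x >] = [< E x, x >] by rewrite EP -sP PEx.
  by rewrite FE EE rdotBl rdotDl; lra.
exists P; split=> // [x|x|x].
- exact: fP.
- rewrite GP; have := F0 x; rewrite FE EE rdotBl rdotDl; lra.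
- rewrite GP => h; apply: kP => u; rewrite sE positive_eq0 ?rdot0r//.
  have [_ _ /(_ x) E0] := (positive_opP E).1 pE; lra.
Qed.

(* With P the support of the positive part of Re Z, with N2 = |P N|,
   P N = W N2 and Z = C N, the operator Y = P (W + C) sqrt(N2) / 2 satisfies
   Y^* Y <= N2 <= N, by operator monotonicity of the square root, and
   Y Y^* >= Re Z, because
   (W + P C) N2 (W + P C)^* - (W - P C) N2 (W - P C)^* = 4 Re (P Z P). *)
Lemma real_part_le Z N : bounded_op Z -> positive_op N ->
  (forall x, nrm (Z x) <= nrm (N x)) ->
  exists U, isometry_op U /\
    forall x, [< Z x, x >] <= [< N (adjoint U x), adjoint U x >].
Proof.
move=> bZ pN ZN; have [bN sN _] := (positive_opP N).1 pN.
have bZ' := bounded_adjoint bZ.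
have [P [bP sP PP leP kP]] : exists P, [/\ bounded_op P,
    forall x y, [< P x, y >] = [< x, P y >], forall x, P (P x) = P x,
    forall x, [< Z x, x >] <= [< Z (P x), P x >] &
    forall x, [< Z (P x), P x >] <= 0 -> P x = 0].
  (* P is built for Z + Z^*, whose quadratic form is 2 Re <Z x, x>. *)
  have bG : bounded_op (Z + adjoint Z) by exact: bounded_opD.
  have GE x : [< (Z + adjoint Z) x, x >] = 2 * [< Z x, x >].
    by rewrite -[(Z + adjoint Z) x]/(Z x + adjoint Z x) rdotDl -adjointEr//
      rdotC; ring.
  have [x y|P [bP sP PP leP kP]] := positive_part_projection bG.
    rewrite -[(Z + adjoint Z) x]/(Z x + adjoint Z x).
    rewrite -[(Z + adjoint Z) y]/(Z y + adjoint Z y).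
    by rewrite rdotDl rdotDr -adjointEr// adjointE// addrC.
  exists P; split=> // x; first by have := leP x; rewrite !GE; lra.
  by move=> h; apply: kP; rewrite GE; lra.
have nP x : nrm (P x) <= nrm x.
  have e : [< x, P x >] = [< P x, P x >] by rewrite sP PP.
  by have := rdot_ge0 (x - P x); rewrite nrm_le rdotBB e; lra.
have [C [bC nC CN _]] := contraction_factor bN bZ ZN.
have bPN : bounded_op (P \o N) by exact: bounded_op_comp.
have [N2 pN2 nN2] := modulus_exists bPN.
have [bN2 sN2 rN2] := (positive_opP N2).1 pN2.
have N2N : forall x, [< N2 x, x >] <= [< N x, x >].
  by apply: loewner => // x; rewrite nN2; exact: nP.
have nPN x : nrm ((P \o N) x) <= nrm (N2 x) by rewrite nN2.
have [W [bW nW WN cW]] := contraction_factor bN2 bPN nPN.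
have [pK KK] := op_sqrtP pN2; set K := op_sqrt N2 in pK KK.
have [bK sK _] := (positive_opP K).1 pK.
have bW' := bounded_adjoint bW; have bC' := bounded_adjoint bC.
have rK x : [< K x, K x >] = [< N2 x, x >] by rewrite -sK KK.
pose Y : H -> H := (2^-1 : R)%:C *: (P \o (W + C) \o K).
have YE x : Y x = (2^-1 : R)%:C *: P (W (K x) + C (K x)) by [].
have bY : bounded_op Y.
  apply/bounded_opZ/bounded_op_comp => //; apply: bounded_op_comp => //.
  exact: bounded_opD.
have Y'E x : adjoint Y x = (2^-1 : R)%:C *: K
  (adjoint W (P x) + adjoint C (P x)).
  apply: rdot_inj => u; rewrite -adjointE// YE rdotZl rdotZr.
  by rewrite sP rdotDl (adjointE _ _ bW) (adjointE _ _ bC) -rdotDr sK.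
have YN x : nrm (Y x) ^+ 2 <= [< N x, x >].
  apply: le_trans (N2N x); rewrite -rK rdotxx ler_sqr ?nnegrE ?nrm_ge0//.
  rewrite YE nrmZ gtr0_norm//;
    apply: le_trans (_ : 2^-1 * (nrm (K x) + nrm (K x)) <= _).
    rewrite ler_pM2l//; apply: le_trans (nP _) _; apply: le_trans (nrmD _ _) _.
    by rewrite lerD.
  lra.
(* Since <Z P x, P x> = <N2 w, e> and |Y^* x|^2 = <N2 (w + e), w + e> / 4, this is positivity of N2
   at w - e. *)
have ZY x : [< Z (P x), P x >] <= nrm (adjoint Y x) ^+ 2.
  pose w := adjoint W (P x); pose e := adjoint C (P x).
  have NPx : N (P x) = N2 w.
    apply: rdot_inj => u; rewrite -sN -sN2 /w -adjointE// WN /=.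
    by rewrite -!sP PP.
  rewrite -CN NPx adjointE// -/e -rdotxx Y'E -/w -/e rdotZl rdotZr rK.
  have := rN2 (w - e); rewrite (opB bN2) (opD bN2).
  rewrite rdotBl !rdotBr rdotDl !rdotDr (sN2 e w) (rdotC e (N2 w)).
  lra.
(* W is a partial isometry from the closed range of N2 onto that of P N. Hence P W = W, and W^* W
   fixes the range of N2, as well as that of K, which has the same kernel as N2. *)
have W'P x : adjoint W (P x) = adjoint W x.
  apply: (range_closure_inj bN2) => // u.
  by rewrite -!adjointE// WN /= -sP PP.
have PW x : P (W x) = W x.
  by apply: rdot_inj => u; rewrite -sP !(adjointEr _ _ bW) W'P.
have W'WN x : adjoint W (W (N2 x)) = N2 x.
  apply: (range_closure_inj bN2) => // u.
  rewrite -adjointE// !WN.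
  by apply: (eq_rdot_isometric bPN bN2) => y; rewrite nN2.
have W'WK x : adjoint W (W (K x)) = K x.
  apply: (range_closure_inj bN2) => // [w hw|u].
    rewrite sK (_ : K w = 0) ?rdot0r//; apply: rdot_eq0; rewrite rK sN2.
    by rewrite -sN2 hw.
  by rewrite -adjointE// (adjointEr _ _ bW) W'WN.
(* For h = W K x, the assumption Y x = 0 yields Y^* h = 0, so <Z h, h> <= 0 and h = 0 by the choice
   of P. Then K x = 0 and P N x = 0; as P x = x, this gives N x = 0, Z x = 0 and finally x = 0. *)
have inj x : Y x = 0 -> x - P x = 0 -> x = 0.
  move=> Yx /eqP; rewrite subr_eq0 => /eqP xP.
  pose y := K x; pose h := W y.
  have hh : [< h, h >] = [< y, y >] by rewrite /h adjointE// W'WK.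
  have PCy : P (C y) = - h.
    move: Yx; rewrite YE => /eqP; rewrite scaler_eq0 => /orP[|/eqP].
      by rewrite (fmorph_eq0 (real_complex R)) invr_eq0 pnatr_eq0.
    by rewrite (opD bP) PW -/y -/h addrC => /eqP; rewrite addr_eq0 => /eqP.
  (* equality case of Cauchy-Schwarz: <C^* h, y> = - |h|^2 with |h| = |y| *)
  have Ch : adjoint C h = - y.
    apply/eqP; rewrite -subr_eq0 opprK; apply/eqP/rdot_le0.
    have -> u v : [< u + v, u + v >] = [< u, u >] + 2 * [< u, v >] + [< v, v >].
      by rewrite rdotDl !rdotDr (rdotC v u); ring.
    have -> : [< adjoint C h, y >] = - [< h, h >].
      by rewrite -adjointEr// -[X in [< X, _ >]]PW sP PCy rdotNr.
    have : [< adjoint C h, adjoint C h >] <= [< h, h >].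
      rewrite -nrm_le; apply: (nrm_contr_adjoint nC) => u v; exact: adjointE.
    by rewrite hh; lra.
  have Yh : adjoint Y h = 0.
    rewrite Y'E PW Ch (_ : adjoint W h = y) ?subrr ?(op0 bK) ?scaler0//.
    exact: W'WK.
  have h0 : h = 0.
    rewrite -[LHS]PW; apply: kP; have := ZY h.
    by rewrite Yh nrm0 expr0n.
  have Kx : K x = 0 by apply: rdot_eq0; rewrite -hh h0 rdot0l.
  have PNx : P (N x) = 0 by apply: nrm_eq0;
    rewrite -[P (N x)]/((P \o N) x) -nN2 -KK Kx (op0 bK) nrm0.
  have Nx : N x = 0.
    by apply: positive_eq0 => //; rewrite {2}xP -sP PNx rdot0l.
  rewrite xP; apply: kP; rewrite -xP.
  by rewrite (_ : Z x = 0) ?rdot0l//; apply/nrm_eq0/le_anti;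
    rewrite nrm_ge0 -nrm0 -Nx ZN.
(* Y^* factors through P on the right, so L = 1 - P maps into ker Y^*. *)
have bL : bounded_op (idfun - P) by apply: bounded_opB => //;
  exact: bounded_op_id.
have [x|U [iU YU]] := isometric_polar bY bL _ inj.
  rewrite Y'E -[(idfun - P) x]/(x - P x) (opB bP) PP subrr.
  by rewrite (op0 bW') (op0 bC') addr0 (op0 bK) scaler0.
exists U; split=> // x; apply: le_trans (leP x) _; apply: le_trans (ZY x) _.
by rewrite YU; exact: YN.
Qed.

(** * The quadratic symmetric modulus of a sum *)

Lemma qsym_modulusP T : bounded_op T -> positive_op (qsym_modulus T) /\
  forall x y, [< qsym_modulus T x, qsym_modulus T y >] =
    2^-1 * ([< T x, T y >] + [< adjoint T x, adjoint T y >]).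
Proof.
move=> bT; have bT' := bounded_adjoint bT.
have E : (2^-1 : R[i]) = (2^-1 : R)%:C
  by rewrite (fmorphV (real_complex R)) rmorph_nat.
pose Q : H -> H := 2^-1 *: ((adjoint T \o T) + (T \o adjoint T)).
have QE x : Q x = (2^-1 : R)%:C *: (adjoint T (T x) + T (adjoint T x)).
  by rewrite -E.
have rQ x y : [< Q x, y >] =
  2^-1 * ([< T x, T y >] + [< adjoint T x, adjoint T y >]).
  by rewrite QE rdotZl rdotDl -adjointEr// (adjointE (adjoint T x) y bT).
have pQ : positive_op Q.
  apply/positive_opP; split=> [|x y|x].
  - by rewrite /Q E; apply/bounded_opZ/bounded_opD; exact: bounded_op_comp.
  - by rewrite (rdotC x) !rQ (rdotC (T y)) (rdotC (adjoint T y)).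
  - by rewrite rQ mulr_ge0// addr_ge0 ?rdot_ge0.
have [pS SS] := op_sqrtP pQ; split=> // x y.
by have [_ sS _] := (positive_opP _).1 pS; rewrite -sS SS rQ.
Qed.

Lemma adjointD A B : bounded_op A -> bounded_op B ->
  adjoint (A + B) = adjoint A + adjoint B.
Proof.
move=> bA bB; apply: adjoint_eq; first exact: bounded_opD.
by move=> x y; rewrite rdotDl rdotDr !adjointE.
Qed.

(* Summand of the polar decomposition of the column (S, S^* ) / sqrt 2, whose
   modulus is [qsym_modulus S], corresponding to the summand A of S. *)
Lemma qsym_modulus_summand S A : bounded_op S -> bounded_op A -> exists Z,
  [/\ bounded_op Z, forall x, nrm (Z x) <= nrm (qsym_modulus A x),
  forall x, range_closure (qsym_modulus S) (Z x) &
  forall u x, [< qsym_modulus S u, Z x >] =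
    2^-1 * ([< S u, A x >] + [< adjoint S u, adjoint A x >])].
Proof.
move=> bS bA; have bS' := bounded_adjoint bS; have bA' := bounded_adjoint bA.
have [pM rM] := qsym_modulusP bS; have [bM _ _] := (positive_opP _).1 pM.
have [pN rN] := qsym_modulusP bA; have [bN _ _] := (positive_opP _).1 pN.
have [k k0 hk] := bounded_op_gt0 bN.
pose b u x := 2^-1 * ([< S u, A x >] + [< adjoint S u, adjoint A x >]).
have [Z [bZ hZ]] : exists Z, bounded_op Z /\ forall x,
    [/\ forall u, [< qsym_modulus S u, Z x >] = b u x,
      range_closure (qsym_modulus S) (Z x)
      & nrm (Z x) <= nrm (qsym_modulus A x)].
  apply: (douglas (k := k)) => // [a u v x|c u x y|x|u x].
  - by rewrite /b !(op_linear bS, op_linear bS') !rdotDl !rdotZl; ring.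
  - rewrite /b !(op_linear bA, op_linear bA') !(opZ bS, opZ bS') !rdotDr
      !rdot_conj.
    by rewrite !conjCK; ring.
  - by rewrite nrm_ge0 hk.
  - apply: le_trans (ler_norm _) _.
    rewrite -ler_sqr ?nnegrE ?mulr_ge0 ?nrm_ge0// exprMn -!rdotxx rM rN !rdotxx.
    rewrite /b real_normK ?num_real//.
    have := ler_normD [< S u, A x >] [< adjoint S u, adjoint A x >].
    have := cauchy_schwarz (S u) (A x).
    have := cauchy_schwarz (adjoint S u) (adjoint A x).
    move: (nrm_ge0 (S u)) (nrm_ge0 (A x)).
    move: (nrm_ge0 (adjoint S u)) (nrm_ge0 (adjoint A x)).
    move: (nrm (S u)) (nrm (A x)) (nrm (adjoint S u)) (nrm (adjoint A x)).
    move=> s r s' r' s'0 r'0 s0 r0 h1 h2 h3.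
    have h : `|[< S u, A x >] + [< adjoint S u, adjoint A x >]| <=
      s * r + s' * r'.
      by lra.
    have : `|[< S u, A x >] + [< adjoint S u, adjoint A x >]| ^+ 2 <=
      (s * r + s' * r') ^+ 2.
      by rewrite ler_sqr ?nnegrE ?addr_ge0 ?mulr_ge0.
    (* Cauchy-Schwarz in the plane: (s^2 + s'^2) (r^2 + r'^2) - (s r + s' r')^2 = (s r' - s'
       r)^2. *)
    rewrite real_normK ?num_real//; have := sqr_ge0 (s * r' - s' * r).
    by move: [< S u, A x >] [< adjoint S u, adjoint A x >] => e f; lra.
exists Z; split=> // [x|x|u x]; by have [? ? ?] := hZ x.
Qed.

End HilbertSpace.

Theorem theorem1p11 (R : realType) (H : hilbertType R) (A B : H -> H)
    (hA : bounded_op A) (hB : bounded_op B) :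
  exists U V : H -> H, isometry_op U /\ isometry_op V /\
    op_le (qsym_modulus (A + B))
      ((U \o qsym_modulus A \o adjoint U) + (V \o qsym_modulus B \o adjoint V)).
Proof.
have hS : bounded_op (A + B) by exact: bounded_opD.
have [pS rS] := qsym_modulusP hS; have [bS sS _] := (positive_opP _).1 pS.
have [pA _] := qsym_modulusP hA; have [bA sA _] := (positive_opP _).1 pA.
have [pB _] := qsym_modulusP hB; have [bB sB _] := (positive_opP _).1 pB.
have [X [bX XA cX rX]] := qsym_modulus_summand hS hA.
have [Y [bY YB cY rY]] := qsym_modulus_summand hS hB.
(* X and Y are Z_A and Z_B. Both sides lie in the closed range of the modulus M of A + B, and their
   pairings with M u agree because the form defining X and Y is additive in the summand. *)
have XY x : qsym_modulus (A + B) x = X x + Y x.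
  apply: (range_closure_inj bS) => [||u].
  - exact: range_closure_image.
  - exact: range_closureD.
  rewrite rS rdotDr rX rY -mulrDr (adjointD hA hB) addrACA.
  by rewrite -!rdotDr.
have [U [[bU UU] leU]] := real_part_le bX pA XA.
have [V [[bV VV] leV]] := real_part_le bY pB YB.
exists U, V; do 2![split=> //].
have bU' := bounded_adjoint bU; have bV' := bounded_adjoint bV.
set T := (X in op_le _ X).
have TE x : T x = U (qsym_modulus A (adjoint U x)) +
  V (qsym_modulus B (adjoint V x)).
  by [].
have DE x : (T - qsym_modulus (A + B)) x = T x - qsym_modulus (A + B) x by [].
apply/positive_opP; split=> [|x y|x].
- by apply: bounded_opB => //; apply: bounded_opD;
    do 2!apply: bounded_op_comp => //.
- rewrite !DE !TE !(rdotBl, rdotBr) sS !(rdotDl, rdotDr); congr (_ + _ - _).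
    by rewrite (adjointE _ _ bU) sA (adjointEr _ _ bU).
  by rewrite (adjointE _ _ bV) sB (adjointEr _ _ bV).
- rewrite DE TE XY rdotBl !rdotDl (adjointE _ _ bU) (adjointE _ _ bV).
  by have := leU x; have := leV x; lra.
Qed.
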